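(* Let $k,n\geq 1$ and let $\Gamma$ be a subgroup of the wreath product $\mathbb{Z}/k\mathbb{Z}\wr S_n$, acting on $nk$ points, and suppose $\Gamma$ has $r$ orbits on these points. Then the proportion $\mathcal{P}(\Gamma)$ of derangements in $\Gamma$ satisfies \[\mathcal{P}(\Gamma)\geq\frac{k-r}{k}.\] Moreover, this inequality is sharp: for fixed $r\le n$ there are subgroups $\Gamma$ of $\mathbb{Z}/k\mathbb{Z}\wr S_n$ with $r$ orbits for which $\mathcal{P}(\Gamma)=\frac{k-r}{k}+O\!\left(\frac{1}{k^2}\right)$ as $k\to\infty$.
   Context: The wreath product $\mathbb{Z}/k\mathbb{Z}\wr S_n$ consists of pairs $((c_1,\dots,c_n),\pi)$ with $c_i\in\mathbb{Z}/k\mathbb{Z}$ and $\pi\in S_n$; it acts on a set of $nk$ points partitioned into $n$ blocks of size $k$, each block arranged as a $k$-cycle, with $\pi$ permuting the blocks and the $c_i$ rotating the blocks cyclically. A derangement is an element fixing no point, and $\mathcal{P}(\Gamma)=|\{\text{derangements in }\Gamma\}|/|\Gamma|$. *)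

(* Defs.v *)
From HB Require Import structures.
From mathcomp Require Import all_boot all_order all_fingroup all_algebra.

Set Implicit Arguments.
Unset Strict Implicit.
Unset Printing Implicit Defensive.

Import GRing.Theory.

(* For k >= 1 this is the additive group of integers mod k, 'I_k with addition
   mod k.  'Z_k is not usable because 'Z_1 is Z/2Z.  The junk value k = 0 gives
   the trivial group. *)
Notation Zmod k := 'I_k.-1.+1.

Record wreath (k n : nat) : Type := Wreath {
  wrot : {ffun 'I_n -> Zmod k};
  wperm : {perm 'I_n}
}.

Definition wreath_pair (k n : nat) (g : wreath k n) := (wrot g, wperm g).
Definition pair_wreath (k n : nat) (p : {ffun 'I_n -> Zmod k} * {perm 'I_n}) :=
  Wreath p.1 p.2.
Lemma wreath_pairK (k n : nat) :
  cancel (@wreath_pair k n) (@pair_wreath k n).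
Proof. by case. Qed.

HB.instance Definition _ (k n : nat) :=
  Finite.copy (wreath k n) (can_type (@wreath_pairK k n)).

(* Products are read from left to right, as for {perm 'I_n}: g * h is g followed
   by h, where (c, p) sends the point x of block i to x + c i in block p i
   (see wreath_act below). *)
Definition wreath_mul (k n : nat) (g h : wreath k n) : wreath k n :=
  Wreath [ffun i => (wrot g i + wrot h (wperm g i))%R] (wperm g * wperm h)%g.
Definition wreath_one (k n : nat) : wreath k n := Wreath [ffun=> 0%R] 1%g.
Definition wreath_inv (k n : nat) (g : wreath k n) : wreath k n :=
  Wreath [ffun i => (- wrot g ((wperm g)^-1%g i))%R] (wperm g)^-1%g.

Lemma wreath_mulA (k n : nat) : associative (@wreath_mul k n).
Proof.
move=> [c p] [d q] [e s]; congr Wreath; last exact: mulgA.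
by apply/ffunP=> i; rewrite !ffunE /= permM addrA.
Qed.

Lemma wreath_mul1 (k n : nat) : left_id (@wreath_one k n) (@wreath_mul k n).
Proof.
move=> [c p]; congr Wreath; last exact: mul1g.
by apply/ffunP=> i; rewrite !ffunE /= perm1 add0r.
Qed.

Lemma wreath_mulV (k n : nat) :
  left_inverse (@wreath_one k n) (@wreath_inv k n) (@wreath_mul k n).
Proof.
move=> [c p]; congr Wreath; last exact: mulVg.
by apply/ffunP=> i; rewrite !ffunE /= addNr.
Qed.

HB.instance Definition _ (k n : nat) := Finite_isGroup.Build (wreath k n)
  (@wreath_mulA k n) (@wreath_mul1 k n) (@wreath_mulV k n).

(* The point (i, x) is the x-th element of the k-cycle of the i-th block. *)
Definition point (k n : nat) : finType := ('I_n * Zmod k)%type.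

Definition wreath_move (k n : nat) (z : point k n) (g : wreath k n) :
  point k n := (wperm g z.1, (z.2 + wrot g z.1)%R).

Lemma wreath_move1 (k n : nat) (z : point k n) : wreath_move z 1%g = z.
Proof. by case: z => i x; rewrite /wreath_move /= perm1 ffunE addr0. Qed.

Lemma wreath_moveM (k n : nat) (z : point k n) (g h : wreath k n) :
  wreath_move z (g * h)%g = wreath_move (wreath_move z g) h.
Proof. by rewrite /wreath_move /= permM ffunE addrA. Qed.

Definition wreath_act (k n : nat) : {action wreath k n &-> point k n} :=
  TotalAction (@wreath_move1 k n) (@wreath_moveM k n).

Definition num_orbits (k n : nat) (G : {group wreath k n}) : nat :=
  #|orbit (wreath_act k n) G @: [set: point k n]|.

Definition derangements (k n : nat) (G : {group wreath k n}) :
  {set wreath k n} := [set g in G | [forall z, wreath_act k n z g != z]].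

Definition derangement_prop (k n : nat) (G : {group wreath k n}) : rat :=
  (#|derangements G|%:R / #|G|%:R)%R.

(* Main.v *)
Require Import Defs.
From mathcomp Require Import all_boot all_order all_fingroup all_algebra.

Set Implicit Arguments.
Unset Strict Implicit.
Unset Printing Implicit Defensive.

(** An element fixing one point of a block fixes the whole block pointwise, so
    it has [k] times as many fixed points as fixed blocks.  By Burnside's lemma
    the mean number of fixed blocks over [G] is therefore [r / k], which bounds
    the proportion of elements having at least one fixed block.

    For sharpness, let [H <= S_n] have [r] orbits and let [G] be the full
    preimage of [H], which contains every rotation of the blocks.  For each pair
    of blocks the elements of [G] fixing both meet the [k ^ 2] rotations of that
    pair trivially, so they make up at most [1 / k ^ 2] of [G].  By a Bonferroni
    inequality, counting fixed blocks instead of elements having one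
    overestimates the proportion of non-derangements by at most
    ['C(n, 2) / k ^ 2]. *)

Import Order.TTheory GRing.Theory Num.Theory.
Local Open Scope ring_scope.

Lemma leq_neq0_addn_bin2 (m : nat) : (m <= (m != 0) + 'C(m, 2))%N.
Proof. by case: m => // m; rewrite binS bin1 addnCA leq_addl. Qed.

Lemma cards_Bonferroni (T : finType) (A : {set T}) :
  (#|A| <= (A != set0) + \sum_(B : {set T} | #|B| == 2) (B \subset A))%N.
Proof.
apply: leq_trans (leq_neq0_addn_bin2 _) _; rewrite cards_eq0 leq_add2l.
rewrite -cards_draws -sum1dep_card big_mkcondl /=.
by apply: leq_sum => B _; case: (B \subset A).
Qed.

Lemma eq_card_imset (aT rT sT : finType) (f : aT -> rT) (g : aT -> sT)
    (A : {set aT}) :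
    {in A &, forall x y, (f x == f y) = (g x == g y)} ->
  #|f @: A| = #|g @: A|.
Proof.
move=> eq_fg; pose fg x := (f x, g x).
have fst_inj : {in fg @: A &, injective fst}.
  move=> _ _ /imsetP[x Ax ->] /imsetP[y Ay ->] /= fxy.
  by congr pair => //; apply/eqP; rewrite -eq_fg ?fxy.
have snd_inj : {in fg @: A &, injective snd}.
  move=> _ _ /imsetP[x Ax ->] /imsetP[y Ay ->] /= gxy.
  by congr pair => //; apply/eqP; rewrite eq_fg ?gxy.
have := card_in_imset snd_inj; rewrite -(card_in_imset fst_inj).
by rewrite -!imset_comp => ->.
Qed.

Section YoungSubgroup.

Variables (T : finType) (rT : eqType) (f : T -> rT).

Definition young_set : {set {perm T}} :=
  [set s : {perm T} | [forall x, f (s x) == f x]].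

Lemma young_group_set : group_set young_set.
Proof.
apply/group_setP; split=> [|s t].
  by rewrite inE; apply/forallP => x /=; rewrite perm1.
rewrite !inE => /forallP fs /forallP ft; apply/forallP => x /=.
by rewrite permM (eqP (ft _)).
Qed.

Definition young_group : {group {perm T}} := Group young_group_set.

Lemma mem_orbit_young (x y : T) :
  (x \in orbit 'P young_group y) = (f x == f y).
Proof.
apply/orbitP/eqP => [[s + <-] | fxy].
  by rewrite inE => /forallP/(_ y)/eqP.
exists (tperm y x); last by rewrite /= apermE tpermL.
by rewrite inE; apply/forallP => z /=; case: tpermP => [->|->|//]; rewrite fxy.
Qed.

End YoungSubgroup.

Lemma card_orbits_young (T rT : finType) (f : T -> rT) :
  #|orbit 'P (young_group f) @: [set: T]| = #|f @: [set: T]|.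
Proof.
by apply: eq_card_imset => x y _ _; rewrite orbit_eq_mem mem_orbit_young.
Qed.

Lemma exists_perm_group_card_orbits (n r : nat) : (0 < r <= n)%N ->
  exists H : {group {perm 'I_n}}, #|orbit 'P H @: [set: 'I_n]| = r.
Proof.
case: r => // r le_rn; pose f (i : 'I_n) : 'I_r.+1 := inord (minn i r).
exists (young_group f); rewrite card_orbits_young -[RHS]card_ord -cardsT.
congr #|pred_of_set _|; apply/setP => j; rewrite in_setT; apply/imsetP.
exists (widen_ord le_rn j) => //.
by rewrite /f /= (minn_idPl (leq_ord j)) inord_val.
Qed.

Section WreathSubgroups.

Variables k n : nat.

Implicit Types (g : wreath k n) (z : point k n) (A : {set 'I_n}).
Implicit Types (G : {group wreath k n}) (H : {group {perm 'I_n}}).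

Local Notation to := (wreath_act k n).

Definition fixed_blocks g : {set 'I_n} :=
  [set i | (wperm g i == i) && (wrot g i == 0)].

Definition block_points A : {set point k n} := setX A [set: Zmod k].

Lemma wreath_act_fixE g z : (to z g == z) = (z.1 \in fixed_blocks g).
Proof.
case: z => i x; rewrite inE xpair_eqE /=.
by rewrite -[X in _ && (_ == X)]addr0 (inj_eq (addrI x)).
Qed.

Lemma afix1_wreath_act g : 'Fix_to[g]%g = block_points (fixed_blocks g).
Proof.
apply/setP => -[i x]; rewrite in_setX in_setT andbT.
by rewrite -(wreath_act_fixE g (i, x)); apply/afix1P/eqP.
Qed.

Lemma sum_card_fixed_blocks G : (0 < k)%N ->
  ((\sum_(g in G) #|fixed_blocks g|) * k = num_orbits G * #|G|)%N.
Proof.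
move=> k_gt0; have acts_setT : [acts G, on [set: point k n] | to].
  by apply/subsetP => g _; rewrite !inE; apply/subsetP => z _; rewrite !inE.
rewrite big_distrl -(Frobenius_Cauchy acts_setT) /=; apply: eq_bigr => g _.
by rewrite setTI afix1_wreath_act cardsX cardsT card_ord prednK.
Qed.

Lemma mean_fixed_blocks G : (0 < k)%N ->
  (\sum_(g in G) #|fixed_blocks g|)%N%:R / #|G|%:R =
    (num_orbits G)%:R / k%:R :> rat.
Proof.
move=> k_gt0; apply/eqP; rewrite eqr_div ?pnatr_eq0 -?lt0n ?cardG_gt0 //.
by rewrite -!natrM sum_card_fixed_blocks.
Qed.

Lemma mem_derangements G g :
  (g \in derangements G) = (g \in G) && (fixed_blocks g == set0).
Proof.
rewrite inE; congr (_ && _); apply/forallP/eqP => [der | fix0 z].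
  by apply/setP => i; rewrite in_set0 -(wreath_act_fixE g (i, 0)); apply/negbTE.
by rewrite wreath_act_fixE fix0 in_set0.
Qed.

Lemma sum_fixed_blocks_neq0 G :
  (\sum_(g in G) (fixed_blocks g != set0) = #|G :\: derangements G|)%N.
Proof.
rewrite -sum1_card big_mkcond [RHS]big_mkcond; apply: eq_bigr => g _ /=.
by rewrite in_setD mem_derangements; case: (g \in G) => //=; case: (_ == _).
Qed.

Lemma derangement_propE G :
  derangement_prop G = 1 - #|G :\: derangements G|%:R / #|G|%:R.
Proof.
have G_neq0 : #|G|%:R != 0 :> rat by rewrite pnatr_eq0 -lt0n cardG_gt0.
have sub_derG : derangements G \subset G.
  by apply/subsetP => g; rewrite mem_derangements => /andP[].
rewrite /derangement_prop cardsDS // natrB ?subset_leq_card //.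
by rewrite mulrBl divff // subKr.
Qed.

Lemma derangement_prop_ge G : (0 < k)%N ->
  (k%:R - (num_orbits G)%:R) / k%:R <= derangement_prop G.
Proof.
move=> k_gt0; rewrite derangement_propE mulrBl divff ?pnatr_eq0 -?lt0n //.
rewrite lerD2l lerN2 -mean_fixed_blocks // ler_wpM2r ?invr_ge0 ?ler0n //.
rewrite ler_nat -sum_fixed_blocks_neq0; apply: leq_sum => g _.
by rewrite -card_gt0; case: #|_|.
Qed.

Definition block_astab G A : {group wreath k n} :=
  'C_G(block_points A | to)%G.

Lemma mem_block_astab G A g :
  (g \in block_astab G A) = (g \in G) && (A \subset fixed_blocks g).
Proof.
rewrite inE; congr (_ && _).
apply/astabP/subsetP => [fixA i Ai | fixA [i x] /setXP[Ai _]].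
  by rewrite -(wreath_act_fixE g (i, 0)) fixA // inE Ai inE.
by apply/eqP; rewrite wreath_act_fixE fixA.
Qed.

Lemma wpermM : {in [set: wreath k n] &, {morph @wperm k n : g h / (g * h)%g}}.
Proof. by []. Qed.

Canonical wperm_morphism := Morphism wpermM.

Local Notation base_group := ('ker (@wperm k n))%G.

Definition block_rotations A : {group wreath k n} :=
  block_astab base_group (~: A).

Lemma card_block_rotations A : (0 < k)%N ->
  #|block_rotations A| = (k ^ #|A|)%N.
Proof.
move=> k_gt0; pose rot c : wreath k n := Wreath c 1%g.
transitivity #|rot @: pffun_on 0 A predT|; last first.
  by rewrite card_imset => [|c d []//]; rewrite card_pffun_on card_ord prednK.
apply: eq_card => g; rewrite mem_block_astab.
apply/andP/imsetP => [[ker_g /subsetP fixAC] | [c /pffun_onP[supp_c _] ->]].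
  exists (wrot g); last by rewrite /rot -(mker ker_g); case: (g).
  apply/pffun_onP; split=> //; apply/subsetP => i; apply: contraR => iA.
  by have := fixAC i; rewrite !inE iA => /(_ isT)/andP[].
split; first exact/kerP.
apply/subsetP => i; rewrite !inE perm1 eqxx /=; apply: contraR.
exact: (subsetP supp_c).
Qed.

Lemma block_rotations_TI G A :
  (block_rotations A :&: block_astab G A = 1)%g.
Proof.
apply/trivgP/subsetP => g /setIP[]; rewrite !mem_block_astab.
move=> /andP[/mker wperm_g fixAC] /andP[_ fixA].
have: [set: 'I_n] \subset fixed_blocks g by rewrite -(setUCr A) subUset fixA.
case: g wperm_g {fixAC fixA} => c _ /= -> /subsetP fixT; apply/set1P.
congr Wreath; apply/ffunP => i; rewrite ffunE.
by have := fixT i; rewrite !inE => /(_ isT)/andP[_ /eqP].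
Qed.

Lemma card_block_astab_le G A : (0 < k)%N -> base_group \subset G ->
  (k ^ #|A| * #|block_astab G A| <= #|G|)%N.
Proof.
move=> k_gt0 baseG; rewrite -card_block_rotations //.
rewrite -TI_cardMg ?block_rotations_TI // subset_leq_card // mul_subG //.
  exact: subset_trans (subsetIl _ _) baseG.
exact: subsetIl.
Qed.

Lemma sum_card_block_astab_pairs_le G : (0 < k)%N -> base_group \subset G ->
  (k ^ 2 * \sum_(B : {set 'I_n} | #|B| == 2) #|block_astab G B| <=
     'C(n, 2) * #|G|)%N.
Proof.
move=> k_gt0 baseG; rewrite -[n in 'C(n, 2)]card_ord -card_draws.
rewrite -sum_nat_const big_distrr big_set /=; apply: leq_sum => B /eqP card_B.
by rewrite -card_B card_block_astab_le.
Qed.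

Lemma sum_card_fixed_blocks_le G :
  (\sum_(g in G) #|fixed_blocks g| <= #|G :\: derangements G| +
     \sum_(B : {set 'I_n} | #|B| == 2) #|block_astab G B|)%N.
Proof.
apply: leq_trans (leq_sum _ (fun g _ => cards_Bonferroni (fixed_blocks g))) _.
rewrite big_split sum_fixed_blocks_neq0 leq_add2l exchange_big /=.
apply: leq_sum => B _; rewrite -sum1_card -big_mkcondr /=.
by apply/eq_leq/eq_bigl => g; rewrite mem_block_astab.
Qed.

Lemma derangement_prop_le G : (0 < k)%N -> base_group \subset G ->
  derangement_prop G <=
    (k%:R - (num_orbits G)%:R) / k%:R + 'C(n, 2)%:R / k%:R ^+ 2.
Proof.
move=> k_gt0 baseG; rewrite derangement_propE mulrBl divff ?pnatr_eq0 -?lt0n //.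
have G_gt0 : 0 < #|G|%:R :> rat by rewrite ltr0n cardG_gt0.
have le_mean := sum_card_fixed_blocks_le G.
set pairs := (\sum_(B : {set _} | _) _)%N in le_mean.
have le_pairs : pairs%:R / #|G|%:R <= 'C(n, 2)%:R / k%:R ^+ 2 :> rat.
  rewrite ler_pdivrMr // mulrAC ler_pdivlMr ?exprn_gt0 ?ltr0n // mulrC.
  by rewrite -natrX -!natrM ler_nat sum_card_block_astab_pairs_le.
rewrite -mean_fixed_blocks // -addrA lerD2l lerNl opprD opprK lerBlDr.
apply: le_trans (lerD (lexx _) le_pairs).
by rewrite -mulrDl ler_wpM2r ?invr_ge0 ?ler0n // -natrD ler_nat.
Qed.

Lemma num_orbits_morphpre_wperm H :
  num_orbits (wperm_morphism @*^-1 H)%G = #|orbit 'P H @: [set: 'I_n]|.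
Proof.
have -> : [set: 'I_n] = fst @: [set: point k n].
  by apply/esym/setP => i; rewrite !inE; apply/imsetP; exists (i, 0).
rewrite -imset_comp; apply: eq_card_imset => z t _ _; rewrite !orbit_eq_mem.
apply/orbitP/orbitP => [[g /morphpreP[_ Hg] <-] | [s Hs zt]].
  by exists (wperm g).
exists (Wreath [ffun=> z.2 - t.2] s); first exact/morphpreP.
by case: z zt => i x /= <-; rewrite /wreath_move /= ffunE [t.2 + _]addrC subrK.
Qed.

End WreathSubgroups.

Theorem theorem3p6 :
  (forall (k n : nat) (G : {group wreath k n}) (r : nat),
     (1 <= k)%N -> (1 <= n)%N -> num_orbits G = r ->
     derangement_prop G >= (k%:R - r%:R) / k%:R)
  /\
  (forall n r : nat, (1 <= r)%N -> (r <= n)%N ->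
     exists G : forall k : nat, {group wreath k n},
       (forall k : nat, (1 <= k)%N -> num_orbits (G k) = r) /\
       (exists (C : rat) (K : nat), forall k : nat, (1 <= k)%N -> (K <= k)%N ->
          `|derangement_prop (G k) - (k%:R - r%:R) / k%:R| <= C / k%:R ^+ 2)).
Proof.
split=> [k n G r k_gt0 _ <- | n r r_gt0 le_rn].
  exact: derangement_prop_ge.
have [|H orbitsH] := @exists_perm_group_card_orbits n r; first by rewrite r_gt0.
pose G k : {group wreath k n} := (wperm_morphism k n @*^-1 H)%G.
have orbitsG k : num_orbits (G k) = r by rewrite num_orbits_morphpre_wperm.
exists G; split=> [k _ // |]; exists 'C(n, 2)%:R, 0%N => k k_gt0 _.
rewrite -(orbitsG k) ger0_norm ?subr_ge0 ?derangement_prop_ge // lerBlDl.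
by rewrite derangement_prop_le ?ker_sub_pre.
Qed.
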